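(* For every integer $n\ge 2$, ${\rm ndi}(K_n^* )=\Delta^*(K_n^* )+1=n$, where $K_n^*$ is the complete symmetric digraph of order $n$.
   Context: The complete symmetric digraph $K_n^*$ has $n$ vertices and, for every two distinct vertices $u,v$, both arcs $uv$ and $vu$. For a digraph $D$ (finite, no loops, no multiple arcs), $\Delta^*(D)$ is the maximum of the maximum outdegree and the maximum indegree. A (proper) $k$-arc-colouring of $D$ is a map $\gamma$ from $A(D)$ to a set of $k$ colours such that arcs with the same head get distinct colours and arcs with the same tail get distinct colours. $S_\gamma^+(u)$, $S_\gamma^-(u)$ are the sets of colours on arcs with tail $u$, resp. head $u$. $\gamma$ is neighbour-distinguishing if for every arc $uv$, $(S_\gamma^+(u),S_\gamma^-(u))\neq(S_\gamma^+(v),S_\gamma^-(v))$ as ordered pairs. ${\rm ndi}(D)$ is the minimum number of colours of a neighbour-distinguishing arc-colouring of $D$. *)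

(* Defs.v *)
From mathcomp Require Import all_boot.

Set Implicit Arguments.
Unset Strict Implicit.
Unset Printing Implicit Defensive.

Record digraph := Digraph {
  vertex :> finType;
  arc : rel vertex;
  arc_irrefl : irreflexive arc
}.

(* The subtype of ordered pairs (u, v) such that uv is an arc. *)
Definition arcs (D : digraph) : finType := {e : D * D | arc e.1 e.2}.

Definition tail (D : digraph) (a : arcs D) : D := (val a).1.
Definition head (D : digraph) (a : arcs D) : D := (val a).2.

Definition outdeg (D : digraph) (u : D) : nat := #|[set a : arcs D | tail a == u]|.
Definition indeg (D : digraph) (u : D) : nat := #|[set a : arcs D | head a == u]|.

Definition Delta_star (D : digraph) : nat :=
  maxn (\max_(u : D) outdeg u) (\max_(u : D) indeg u).

Definition arc_colouring (D : digraph) (k : nat) := {ffun arcs D -> 'I_k}.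

Section Colouring.
Variables (D : digraph) (k : nat) (g : arc_colouring D k).

Definition proper_colouring : bool :=
  [forall a, forall b,
     (a != b) && ((head a == head b) || (tail a == tail b)) ==> (g a != g b)].

Definition Sout (u : D) : {set 'I_k} := [set g a | a : arcs D & tail a == u].
Definition Sin (u : D) : {set 'I_k} := [set g a | a : arcs D & head a == u].

Definition neighbour_distinguishing : bool :=
  [forall u : D, forall v : D,
     arc u v ==> ((Sout u, Sin u) != (Sout v, Sin v))].

End Colouring.

Definition nd_colourable (D : digraph) (k : nat) : bool :=
  [exists g : arc_colouring D k,
     proper_colouring g && neighbour_distinguishing g].

(* Giving all arcs different colours is always neighbour-distinguishing, so the
   minimum defining ndi exists for every digraph. *)
Lemma nd_colourable_ex (D : digraph) : exists k, nd_colourable D k.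
Proof.
exists #|arcs D|; apply/existsP; exists [ffun a => enum_rank a].
apply/andP; split.
  apply/forallP=> a; apply/forallP=> b; apply/implyP=> /andP[ab _].
  by rewrite !ffunE (inj_eq enum_rank_inj).
apply/forallP=> u; apply/forallP=> v; apply/implyP=> uv.
apply/eqP=> -[Suv _].
pose a : arcs D := exist _ (u, v) uv.
have: enum_rank a \in Sout [ffun a : arcs D => enum_rank a] u.
  by apply/imsetP; exists a; rewrite ?ffunE ?inE.
rewrite Suv => /imsetP[b]; rewrite inE ffunE => /eqP tb /enum_rank_inj ab.
by have := arc_irrefl v; rewrite -{1}tb -ab uv.
Qed.

Definition ndi (D : digraph) : nat := ex_minn (nd_colourable_ex D).

Lemma neq_irrefl (T : eqType) : irreflexive (fun u v : T => u != v).
Proof. by move=> u; rewrite eqxx. Qed.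

Definition complete_symmetric (n : nat) : digraph :=
  @Digraph 'I_n (fun u v => u != v) (@neq_irrefl 'I_n).

(* Main.v *)
Require Import Defs.
From mathcomp Require Import all_boot.
From mathcomp Require Import zify.
(* Imported last so that [arc] and [head] are not those of [path] and [seq]. *)
Import Defs.

(* In a proper colouring of K_n^* every vertex sees n - 1 out-colours and n - 1
   in-colours, so with n - 1 colours all vertices see everything and none are
   distinguished.  With n colours each vertex misses exactly one out-colour, and
   it suffices that the missed out-colours are pairwise distinct.  Record the
   colour of uv in the entry (u, v) of a square, and the out-colour missed by u
   in the entry (u, u).  For odd n take u + v mod n.  For even n >= 4 put
   m = n - 1, colour K_m^* by u + v mod m and use the then unused colour 2u for
   both arcs joining u to an extra vertex; finally recolour every arc (u, u + 1)
   with the new colour m, so that u misses the out-colour 2u + 1 and the extra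
   vertex misses m. *)

Section Digraph.
Variable D : digraph.

Lemma arcs_inj (a b : arcs D) : tail a = tail b -> head a = head b -> a = b.
Proof.
rewrite /tail /head => t h; apply: val_inj.
by rewrite [val a]surjective_pairing t h -surjective_pairing.
Qed.

Lemma outdegE (u : D) : outdeg u = #|[set v | arc u v]|.
Proof.
rewrite /outdeg -(@card_in_imset _ _ (@head D)).
  apply: eq_card => v; rewrite inE; apply/imsetP/idP => [[a]|uv].
    by rewrite inE => /eqP <- ->; exact: (valP a).
  by exists (exist _ (u, v) uv); rewrite ?inE /tail /=.
by move=> a b; rewrite !inE => /eqP ta /eqP tb; apply: arcs_inj; rewrite ta tb.
Qed.

Lemma indegE (u : D) : indeg u = #|[set v | arc v u]|.
Proof.
rewrite /indeg -(@card_in_imset _ _ (@tail D)).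
  apply: eq_card => v; rewrite inE; apply/imsetP/idP => [[a]|vu].
    by rewrite inE => /eqP <- ->; exact: (valP a).
  by exists (exist _ (v, u) vu); rewrite ?inE /head /=.
by move=> a b; rewrite !inE => /eqP ta /eqP tb ?; apply: arcs_inj; rewrite ?ta ?tb.
Qed.

Variables (k : nat) (g : arc_colouring D k).
Hypothesis g_proper : proper_colouring g.

Lemma proper_colouringP (a b : arcs D) :
  (head a == head b) || (tail a == tail b) -> g a = g b -> a = b.
Proof.
move=> hab gab; apply/eqP; apply: contraT => nab.
by move/forallP/(_ a)/forallP/(_ b): g_proper; rewrite nab hab gab eqxx.
Qed.

(** Properness makes [g] injective on the arcs sharing a tail. *)
Lemma card_Sout (u : D) : #|Sout g u| = outdeg u.
Proof.
apply: card_in_imset => a b; rewrite !inE => /eqP ta /eqP tb.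
by apply: proper_colouringP; rewrite ta tb eqxx orbT.
Qed.

Lemma card_Sin (u : D) : #|Sin g u| = indeg u.
Proof.
apply: card_in_imset => a b; rewrite !inE => /eqP ta /eqP tb.
by apply: proper_colouringP; rewrite ta tb eqxx.
Qed.

End Digraph.

Section CompleteSymmetric.
Variable n : nat.
Local Notation K := (complete_symmetric n).

Lemma outdeg_complete (u : K) : outdeg u = n.-1.
Proof.
have -> : n.-1 = #|[set~ u : 'I_n]| by rewrite cardsC1 card_ord.
by rewrite outdegE; apply: eq_card => v; rewrite !inE /= eq_sym.
Qed.

Lemma indeg_complete (u : K) : indeg u = n.-1.
Proof.
have -> : n.-1 = #|[set~ u : 'I_n]| by rewrite cardsC1 card_ord.
by rewrite indegE; apply: eq_card => v; rewrite !inE.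
Qed.

Lemma Delta_star_complete : 0 < n -> Delta_star K = n.-1.
Proof.
move=> n_gt0; have cardK : 0 < #|K| by rewrite card_ord.
rewrite /Delta_star.
have [u ->] := eq_bigmax (@outdeg K) cardK.
have [v ->] := eq_bigmax (@indeg K) cardK.
by rewrite outdeg_complete indeg_complete maxnn.
Qed.

Lemma nd_colourable_complete_leq (k : nat) :
  1 < n -> nd_colourable K k -> n <= k.
Proof.
move=> n_gt1 /existsP[g /andP[g_proper g_nd]].
pose u : K := Ordinal (ltnW n_gt1); pose v : K := Ordinal n_gt1.
rewrite leqNgt; apply/negP => lt_kn.
(* As [k < n], there are at most n - 1 colours, so n - 1 of them are all. *)
have full (S : {set 'I_k}) : #|S| = n.-1 -> S = setT.
  by move=> cS; apply/eqP; rewrite eqEcard subsetT cardsT card_ord cS; lia.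
have SoutT w : Sout g w = setT by apply: full; rewrite card_Sout ?outdeg_complete.
have SinT w : Sin g w = setT by apply: full; rewrite card_Sin ?indeg_complete.
have := implyP (forallP (forallP g_nd u) v) isT.
by rewrite !SoutT !SinT eqxx.
Qed.

(* The entry L u u is the colour missing from the arcs with tail u. *)
Lemma nd_colourable_square (L : nat -> nat -> nat) :
  (forall u v, u < n -> v < n -> L u v < n) ->
  (forall u v w, u < n -> v < n -> w < n -> L u v = L u w -> v = w) ->
  (forall u v w, u < n -> v < n -> w < n -> v <> u -> w <> u ->
     L v u = L w u -> v = w) ->
  (forall u v, u < n -> v < n -> L u u = L v v -> u = v) ->
  nd_colourable K n.
Proof.
move=> L_lt L_row L_col L_diag.
pose c (u v : K) : K := Ordinal (L_lt u v (ltn_ord u) (ltn_ord v)).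
have c_row (u : K) : injective (c u).
  by move=> v w [] /L_row vw; apply/val_inj/vw.
pose g : arc_colouring K n := [ffun a : arcs K => c (tail a) (head a)].
have SoutE (u : K) : Sout g u = [set~ c u u].
  apply/setP => x; rewrite !inE; apply/imsetP/idP => [[a]|xu].
    rewrite inE ffunE => /eqP <- ->; rewrite (inj_eq (c_row _)) eq_sym.
    exact: (valP a).
  (* An injective row permutes the colours, so every colour other than [c u u] sits off the
     diagonal, hence on an arc. *)
  have [c' _ cK] := injF_bij (c_row u).
  have uv : u != c' x by apply: contra xu => /eqP {2}->; rewrite cK.
  by exists (exist _ (u, c' x) uv); rewrite ?inE ?ffunE /tail /head /= ?cK.
apply/existsP; exists g; apply/andP; split.
  apply/forallP => a; apply/forallP => b; apply/implyP => /andP[ab hab].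
  apply: contra ab; rewrite !ffunE => /eqP gab; apply/eqP.
  case/orP: hab => /eqP hab; apply: arcs_inj => //; last first.
    by apply: (c_row (tail a)); rewrite gab hab.
  have na (x : arcs K) : val (tail x) <> val (head x).
    by move/val_inj/eqP; apply/negP; exact: (valP x).
  apply/val_inj/(L_col (head a)); rewrite ?ltn_ord //; first by rewrite hab.
  by move/(congr1 val): gab; rewrite /= hab.
apply/forallP => u; apply/forallP => v; apply/implyP => /= uv.
apply: contra uv => /eqP[]; rewrite !SoutE => /setC_inj/set1_inj[] /L_diag uv _.
exact/eqP/val_inj/uv.
Qed.

End CompleteSymmetric.

(** For [u, v < m] one conditional subtraction reduces modulo [m], within reach of linear
    arithmetic. *)
Definition addmod (m u v : nat) : nat := if u + v < m then u + v else u + v - m.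

(** Index [m] is the extra vertex, value [m] the new colour; for [u < m], [s] is the cyclic
    successor of [u] modulo [m]. *)
Definition even_square (m u v : nat) : nat :=
  let s := if u.+1 == m then 0 else u.+1 in
  if u == m then (if v == m then m else addmod m v v)
  else if v == m then addmod m u u
  else if v == u then addmod m u s
  else if v == s then m
  else addmod m u v.

(* Innermost conditionals are split first. *)
Ltac case_lia :=
  repeat match goal with
  | |- context [if ?a == ?b then _ else _] =>
      lazymatch b with context [if _ then _ else _] => fail | _ => idtac end;
      case: (@eqP _ a b) => ?; subst; try done; try (exfalso; lia)
  end;
  repeat match goal with
  | |- context [if leq ?a ?b then _ else _] => case: (leqP a b) => ?
  end;
  lia.

Lemma nd_colourable_complete_odd (n : nat) :
  odd n -> nd_colourable (complete_symmetric n) n.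
Proof.
move=> n_odd; apply: (@nd_colourable_square n (addmod n)); rewrite /addmod.
- by move=> u v ? ?; case_lia.
- by move=> u v w ? ? ?; case_lia.
- by move=> u v w ? ? ? ? ?; case_lia.
(* Doubling is injective modulo an odd number. *)
- by move=> u v ? ?; case_lia.
Qed.

Lemma nd_colourable_complete_even (m : nat) :
  1 < m -> odd m -> nd_colourable (complete_symmetric m.+1) m.+1.
Proof.
move=> m_gt1 m_odd; apply: (@nd_colourable_square _ (even_square m));
  rewrite /even_square /addmod.
- by move=> u v ? ?; case_lia.
(* Row [u < m] is the row of sums u + v with 2u moved to column [m], 2u + 1 moved to the diagonal,
   and [m] filling the gap at [s]. *)
- by move=> u v w ? ? ?; case_lia.
- by move=> u v w ? ? ? ? ?; case_lia.
- by move=> u v ? ?; case_lia.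
Qed.

Lemma nd_colourable_complete (n : nat) :
  1 < n -> nd_colourable (complete_symmetric n) n.
Proof.
move=> n_gt1; have [n_odd|n_even] := boolP (odd n).
  exact: nd_colourable_complete_odd.
case: n n_gt1 n_even => // m m_gt0; rewrite /= negbK => m_odd.
have [m_gt1|m_le1] := ltnP 1 m; first exact: nd_colourable_complete_even.
have -> : m = 1 by lia.
(* For [m = 1] the successor of 0 would be 0 itself; each arc is coloured by its head instead. *)
by apply: (@nd_colourable_square 2 (fun _ v => v)) => //; lia.
Qed.

Theorem theorem7 (n : nat) (hn : 2 <= n) :
  ndi (complete_symmetric n) = Delta_star (complete_symmetric n) + 1 /\
  Delta_star (complete_symmetric n) + 1 = n.
Proof.
have -> : Delta_star (complete_symmetric n) + 1 = n.
  by rewrite Delta_star_complete; lia.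
split=> //; rewrite /ndi; case: ex_minnP => k k_col k_min; apply/eqP.
by rewrite eqn_leq (k_min _ (nd_colourable_complete _ hn))
  (nd_colourable_complete_leq _ _ hn k_col).
Qed.
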